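(* Let $k,n\geq 1$ and let $\Gamma$ be a subgroup of the wreath product $\mathbb{Z}/k\mathbb{Z}\wr S_n$, acting on $nk$ points, and suppose $\Gamma$ has $r$ orbits on these points. Then the proportion $\mathcal{P}(\Gamma)$ of derangements in $\Gamma$ satisfies \[\mathcal{P}(\Gamma)\geq\frac{k-r}{k}.\] Moreover, this inequality is sharp: for fixed $r\le n$ there are subgroups $\Gamma$ of $\mathbb{Z}/k\mathbb{Z}\wr S_n$ with $r$ orbits for which $\mathcal{P}(\Gamma)=\frac{k-r}{k}+O\!\left(\frac{1}{k^2}\right)$ as $k\to\infty$.
   Context: The wreath product $\mathbb{Z}/k\mathbb{Z}\wr S_n$ consists of pairs $((c_1,\dots,c_n),\pi)$ with $c_i\in\mathbb{Z}/k\mathbb{Z}$ and $\pi\in S_n$; it acts on a set of $nk$ points partitioned into $n$ blocks of size $k$, each block arranged as a $k$-cycle, with $\pi$ permuting the blocks and the $c_i$ rotating the blocks cyclically. A derangement is an element fixing no point, and $\mathcal{P}(\Gamma)=|\{\text{derangements in }\Gamma\}|/|\Gamma|$. *)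

(* Defs.v *)
From HB Require Import structures.
From mathcomp Require Import all_boot all_order all_fingroup all_algebra.

Set Implicit Arguments.
Unset Strict Implicit.
Unset Printing Implicit Defensive.

Import GRing.Theory.

(* For k >= 1 this is the additive group of integers mod k, 'I_k with addition
   mod k.  'Z_k is not usable because 'Z_1 is Z/2Z.  The junk value k = 0 gives
   the trivial group. *)
Notation Zmod k := 'I_k.-1.+1.

Record wreath (k n : nat) : Type := Wreath {
  wrot : {ffun 'I_n -> Zmod k};
  wperm : {perm 'I_n}
}.

Definition wreath_pair (k n : nat) (g : wreath k n) := (wrot g, wperm g).
Definition pair_wreath (k n : nat) (p : {ffun 'I_n -> Zmod k} * {perm 'I_n}) :=
  Wreath p.1 p.2.
Lemma wreath_pairK (k n : nat) :
  cancel (@wreath_pair k n) (@pair_wreath k n).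
Proof. by case. Qed.

HB.instance Definition _ (k n : nat) :=
  Finite.copy (wreath k n) (can_type (@wreath_pairK k n)).

(* Products are read from left to right, as for {perm 'I_n}: g * h is g followed
   by h, where (c, p) sends the point x of block i to x + c i in block p i
   (see wreath_act below). *)
Definition wreath_mul (k n : nat) (g h : wreath k n) : wreath k n :=
  Wreath [ffun i => (wrot g i + wrot h (wperm g i))%R] (wperm g * wperm h)%g.
Definition wreath_one (k n : nat) : wreath k n := Wreath [ffun=> 0%R] 1%g.
Definition wreath_inv (k n : nat) (g : wreath k n) : wreath k n :=
  Wreath [ffun i => (- wrot g ((wperm g)^-1%g i))%R] (wperm g)^-1%g.

Lemma wreath_mulA (k n : nat) : associative (@wreath_mul k n).
Proof.
move=> [c p] [d q] [e s]; congr Wreath; last exact: mulgA.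
by apply/ffunP=> i; rewrite !ffunE /= permM addrA.
Qed.

Lemma wreath_mul1 (k n : nat) : left_id (@wreath_one k n) (@wreath_mul k n).
Proof.
move=> [c p]; congr Wreath; last exact: mul1g.
by apply/ffunP=> i; rewrite !ffunE /= perm1 add0r.
Qed.

Lemma wreath_mulV (k n : nat) :
  left_inverse (@wreath_one k n) (@wreath_inv k n) (@wreath_mul k n).
Proof.
move=> [c p]; congr Wreath; last exact: mulVg.
by apply/ffunP=> i; rewrite !ffunE /= addNr.
Qed.

HB.instance Definition _ (k n : nat) := Finite_isGroup.Build (wreath k n)
  (@wreath_mulA k n) (@wreath_mul1 k n) (@wreath_mulV k n).

(* The point (i, x) is the x-th element of the k-cycle of the i-th block. *)
Definition point (k n : nat) : finType := ('I_n * Zmod k)%type.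

Definition wreath_move (k n : nat) (z : point k n) (g : wreath k n) :
  point k n := (wperm g z.1, (z.2 + wrot g z.1)%R).

Lemma wreath_move1 (k n : nat) (z : point k n) : wreath_move z 1%g = z.
Proof. by case: z => i x; rewrite /wreath_move /= perm1 ffunE addr0. Qed.

Lemma wreath_moveM (k n : nat) (z : point k n) (g h : wreath k n) :
  wreath_move z (g * h)%g = wreath_move (wreath_move z g) h.
Proof. by rewrite /wreath_move /= permM ffunE addrA. Qed.

Definition wreath_act (k n : nat) : {action wreath k n &-> point k n} :=
  TotalAction (@wreath_move1 k n) (@wreath_moveM k n).

Definition num_orbits (k n : nat) (G : {group wreath k n}) : nat :=
  #|orbit (wreath_act k n) G @: [set: point k n]|.

Definition derangements (k n : nat) (G : {group wreath k n}) :
  {set wreath k n} := [set g in G | [forall z, wreath_act k n z g != z]].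

Definition derangement_prop (k n : nat) (G : {group wreath k n}) : rat :=
  (#|derangements G|%:R / #|G|%:R)%R.

(* Main.v *)
Require Import Defs.
From mathcomp Require Import all_boot all_order all_fingroup all_algebra.

Set Implicit Arguments.
Unset Strict Implicit.
Unset Printing Implicit Defensive.

(** An element fixing one point of a block fixes the whole block pointwise, so
    it has [k] times as many fixed points as fixed blocks.  By Burnside's lemma
    the average number of fixed blocks over [G] is therefore [r / k], which
    bounds the proportion of elements having at least one fixed block.

    For sharpness, colour the blocks with [r] colours and let [G] be the group
    of all elements preserving the colours.  Two given distinct blocks are
    both fixed by a proportion at most [1 / k^2] of [G], so by a Bonferroni
    inequality elements with several fixed blocks only contribute [n^2 / k^2]. *)

Import Order.TTheory GRing.Theory Num.Theory.
Local Open Scope ring_scope.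

Definition fixed_blocks (k n : nat) (g : wreath k n) : {set 'I_n} :=
  [set i | (wperm g i == i) && (wrot g i == 0)].

Lemma wreath_act_fixE (k n : nat) (g : wreath k n) (z : point k n) :
  (wreath_act k n z g == z) = (z.1 \in fixed_blocks g).
Proof.
case: z => i x; rewrite inE /= /wreath_move /= xpair_eqE.
by rewrite -[X in _ && (_ == X)]addr0 (inj_eq (addrI x)).
Qed.

Lemma card_Fix_wreath (k n : nat) (g : wreath k n) : (0 < k)%N ->
  #|'Fix_([set: point k n] | wreath_act k n)[g]%g| = (#|fixed_blocks g| * k)%N.
Proof.
move=> k_gt0; transitivity #|setX (fixed_blocks g) [set: Zmod k]|.
  apply: eq_card => -[i x]; rewrite in_setI in_setT in_setX in_setT andbT.
  by rewrite -(wreath_act_fixE g (i, x)); apply/afix1P/eqP.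
by rewrite cardsX cardsT card_ord prednK.
Qed.

Lemma sum_card_fixed_blocks (k n : nat) (G : {group wreath k n}) : (0 < k)%N ->
  ((\sum_(g in G) #|fixed_blocks g|) * k = num_orbits G * #|G|)%N.
Proof.
(* [Frobenius_Cauchy] is Burnside's lemma; its side condition, that [G] preserves the set of all
   points, is settled last. *)
move=> k_gt0; rewrite big_distrl /= -Frobenius_Cauchy.
  by apply: eq_bigr => g _; rewrite card_Fix_wreath.
by apply/subsetP => g _; rewrite !inE; apply/subsetP => z; rewrite !inE.
Qed.

Lemma derangementsE (k n : nat) (G : {group wreath k n}) :
  derangements G = [set g in G | fixed_blocks g == set0].
Proof.
apply/setP => g; rewrite !in_set; congr (_ && _).
apply/forallP/eqP => [der | fix0 z].
  by apply/setP => i; rewrite in_set0 -(wreath_act_fixE g (i, 0)); apply/negbTE.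
by rewrite wreath_act_fixE fix0 in_set0.
Qed.

Lemma card_derangementsC (k n : nat) (G : {group wreath k n}) :
  (#|derangements G| + \sum_(g in G) (fixed_blocks g != set0) = #|G|)%N.
Proof.
rewrite derangementsE -sum1dep_card big_mkcondr -big_split /=.
by rewrite -sum1_card; apply: eq_bigr => g _; case: (_ == _).
Qed.

(** Markov's inequality: the indicator of having a fixed block is at most the number of fixed
    blocks. *)
Lemma sum_nonderangement_le (k n : nat) (G : {group wreath k n}) : (0 < k)%N ->
  (k * \sum_(g in G) (fixed_blocks g != set0) <= num_orbits G * #|G|)%N.
Proof.
move=> k_gt0; rewrite -sum_card_fixed_blocks // mulnC leq_mul2r.
rewrite leq_sum ?orbT //.
by move=> g _; rewrite -card_gt0; case: #|_|.
Qed.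

Lemma derangement_propE (k n : nat) (G : {group wreath k n}) :
  derangement_prop G =
    1 - (\sum_(g in G) (fixed_blocks g != set0))%N%:R / #|G|%:R.
Proof.
rewrite /derangement_prop.
have G0 : #|G|%:R != 0 :> rat by rewrite pnatr_eq0 -lt0n cardG_gt0.
apply: (mulIf G0); rewrite mulrBl !divfK // mul1r.
by rewrite -[X in X%:R - _](card_derangementsC G) natrD addrK.
Qed.

Lemma derangement_prop_ge (k n : nat) (G : {group wreath k n}) : (0 < k)%N ->
  (k%:R - (num_orbits G)%:R) / k%:R <= derangement_prop G.
Proof.
move=> k_gt0; have k0 : 0 < k%:R :> rat by rewrite ltr0n.
have G0 : 0 < #|G|%:R :> rat by rewrite ltr0n cardG_gt0.
rewrite derangement_propE mulrBl divff ?gt_eqF // lerD2l lerN2.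
rewrite ler_pdivlMr // mulrAC ler_pdivrMr // mulrC -!natrM ler_nat.
exact: sum_nonderangement_le.
Qed.

Lemma card_fixed_blocks_Bonferroni (k n : nat) (g : wreath k n) :
  (#|fixed_blocks g| <= (fixed_blocks g != set0) +
     \sum_(p : 'I_n * 'I_n | p.1 != p.2)
        ((p.1 \in fixed_blocks g) && (p.2 \in fixed_blocks g)))%N.
Proof.
have [->|[i gi]] := set_0Vmem (fixed_blocks g); first by rewrite cards0.
have -> : fixed_blocks g != set0 by apply/set0Pn; exists i.
rewrite (cardsD1 i) gi leq_add2l -big_mkcondr /= sum1_card.
(* The pairs [(i, j)], with [j] running over the other fixed blocks, already supply enough terms of
   the sum. *)
rewrite -(card_imset (_ :\ _) (fun j l (e : (i, j) = (i, l)) => congr1 snd e)).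
apply/subset_leq_card/subsetP => _ /imsetP[j /setD1P[ji gj] ->].
by rewrite unfold_in /= eq_sym ji gi.
Qed.

Section ColouredBlocks.

Variables (n : nat) (T : eqType) (f : 'I_n -> T).

(** Rotations are unconstrained, so this is the direct product, over the colour classes, of full
    wreath products. *)
Definition colour_set (k : nat) : {set wreath k n} :=
  [set g | [forall i, f (wperm g i) == f i]].

Lemma colour_group_set (k : nat) : group_set (colour_set k).
Proof.
apply/group_setP; split=> [|g h].
  by rewrite inE; apply/forallP => i /=; rewrite perm1.
rewrite !inE => /forallP gf /forallP hf; apply/forallP => i /=.
by rewrite permM (eqP (hf _)).
Qed.

Definition colour_group (k : nat) : {group wreath k n} :=
  Group (colour_group_set k).

Lemma orbit_colour_group (k : nat) (z t : point k n) :
  (t \in orbit (wreath_act k n) (colour_group k) z) = (f t.1 == f z.1).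
Proof.
apply/orbitP/eqP => [[g gG <-] | ftz].
  by move: gG; rewrite inE => /forallP /(_ z.1)/eqP.
(* Swapping two blocks of equal colour preserves colours, and the constant rotation carries [z.2] to
   [t.2]. *)
exists (Wreath [ffun=> t.2 - z.2] (tperm z.1 t.1)).
  rewrite inE; apply/forallP => i /=.
  by case: tpermP => [->|->|//]; rewrite ftz.
by case: t {ftz} => j y; rewrite /= /wreath_move /= tpermL ffunE addrC subrK.
Qed.

(* Overwriting the rotations of blocks [i] and [j] stays inside the group. *)
Lemma card_colour_group_fix2 (k : nat) (i j : 'I_n) : (0 < k)%N -> i != j ->
  (k ^ 2 * \sum_(g in colour_group k)
      ((i \in fixed_blocks g) && (j \in fixed_blocks g)) <= #|colour_group k|)%N.
Proof.
move=> k_gt0 ij; rewrite -big_mkcondr /= sum1dep_card.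
set A := [set g | _].
pose h (u : wreath k n * (Zmod k * Zmod k)) :=
  Wreath [ffun l => if l == i then u.2.1 else if l == j then u.2.2
                    else wrot u.1 l] (wperm u.1).
(* Elements of [A] have zero rotation at [i] and [j], so overwriting these two values loses no
   information. *)
have h_inj : {in setX A setT &, injective h}.
  move=> [[c p] [a b]] [[d q] [a' b']] /setXP[+ _] /setXP[+ _] /=.
  rewrite !inE /= => /and3P[_ /andP[_ /eqP ci] /andP[_ /eqP cj]].
  move=> /and3P[_ /andP[_ /eqP di] /andP[_ /eqP dj]] [/ffunP e ->].
  have ea := e i; have eb := e j.
  rewrite !ffunE /= eqxx in ea; rewrite !ffunE /= eq_sym (negbTE ij) eqxx in eb.
  rewrite ea eb; congr (Wreath _ _, _); apply/ffunP => l.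
  have := e l; rewrite !ffunE /=.
  have [->|_] := eqVneq l i; first by rewrite ci di.
  by have [->|] := eqVneq l j; rewrite ?cj ?dj.
have <- : #|setX A [set: Zmod k * Zmod k]| = (k ^ 2 * #|A|)%N.
  by rewrite cardsX cardsT card_prod card_ord prednK // mulnn mulnC.
rewrite -(card_in_imset h_inj).
apply/subset_leq_card/subsetP => _ /imsetP[u + ->].
by rewrite !inE => /andP[/andP[]].
Qed.

(** Sum the Bonferroni inequality over the group and multiply by [k ^ 2]: Burnside evaluates the
    left side, and each of the at most [n ^ 2] pairs of distinct blocks contributes at most the
    order of the group. *)
Lemma sum_nonderangement_colour_ge (k : nat) : (0 < k)%N ->
  (k * (num_orbits (colour_group k) * #|colour_group k|) <=
    k ^ 2 * (\sum_(g in colour_group k) (fixed_blocks g != set0))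
    + n ^ 2 * #|colour_group k|)%N.
Proof.
move=> k_gt0; rewrite -sum_card_fixed_blocks // mulnCA mulnn mulnC.
have := leq_sum (index_enum _) (fun g (_ : g \in colour_group k) =>
                   card_fixed_blocks_Bonferroni g).
rewrite -(leq_pmul2l (m := k ^ 2)) ?expn_gt0 ?k_gt0 // => /leq_trans; apply.
rewrite big_split mulnDr leq_add2l exchange_big big_distrr /=.
apply: (@leq_trans (\sum_(p : 'I_n * 'I_n | p.1 != p.2) #|colour_group k|)).
  by apply: leq_sum => -[i j] /= ij; apply: card_colour_group_fix2.
rewrite sum_nat_const leq_mul2r; apply/orP; right.
by rewrite (leq_trans (max_card _)) // card_prod card_ord.
Qed.

Lemma derangement_prop_colour_le (k : nat) : (0 < k)%N ->
  `|derangement_prop (colour_group k)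
    - (k%:R - (num_orbits (colour_group k))%:R) / k%:R|
  <= (n ^ 2)%:R / k%:R ^+ 2.
Proof.
move=> k_gt0; have k0 : 0 < k%:R :> rat by rewrite ltr0n.
have G0 : 0 < #|colour_group k|%:R :> rat by rewrite ltr0n cardG_gt0.
(* The general lower bound removes the absolute value, leaving the number of orbits over [k] minus
   the proportion of non-derangements. *)
rewrite ger0_norm ?subr_ge0 ?derangement_prop_ge // derangement_propE.
rewrite mulrBl divff ?gt_eqF // opprB addrC addrA subrK.
rewrite ler_pdivlMr ?exprn_gt0 // -(ler_pM2r G0) mulrAC mulrBl divfK ?gt_eqF //.
have := sum_nonderangement_colour_ge k_gt0.
set N := (\sum_(g in _) _)%N; rewrite -(ler_nat rat) !(natrD, natrM) => le_N.
rewrite mulrBl lerBlDl expr2 [N%:R * _]mulrC.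
by rewrite [_ / _ * _]mulrAC mulrA divfK ?gt_eqF // [leLHS]mulrC.
Qed.

End ColouredBlocks.

Lemma num_orbits_colour_group (n : nat) (T : finType) (f : 'I_n -> T)
    (k : nat) :
  num_orbits (colour_group f k) = #|f @: setT|.
Proof.
pose S (c : T) : {set point k n} := [set z | f z.1 == c].
have S_inj : {in f @: setT &, injective S}.
  (* An attained colour [f i] is recovered from its class through the point [(i, 0)]. *)
  move=> _ c /imsetP[i _ ->] _ /setP/(_ (i, 0)); rewrite !inE eqxx.
  by move/esym/eqP.
rewrite -(card_in_imset S_inj) -imset_comp; congr #|pred_of_set _|.
have orbE z : orbit (wreath_act k n) (colour_group f k) z = S (f z.1).
  by apply/setP => t; rewrite orbit_colour_group inE.
apply/setP => B; apply/imsetP/imsetP => [[z _ ->] | [i _ ->]].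
  by exists z.1; rewrite // orbE.
by exists (i, 0); rewrite // orbE.
Qed.

Theorem theorem3p6 :
  (forall (k n : nat) (G : {group wreath k n}) (r : nat),
     (1 <= k)%N -> (1 <= n)%N -> num_orbits G = r ->
     derangement_prop G >= (k%:R - r%:R) / k%:R)
  /\
  (forall n r : nat, (1 <= r)%N -> (r <= n)%N ->
     exists G : forall k : nat, {group wreath k n},
       (forall k : nat, (1 <= k)%N -> num_orbits (G k) = r) /\
       (exists (C : rat) (K : nat), forall k : nat, (1 <= k)%N -> (K <= k)%N ->
          `|derangement_prop (G k) - (k%:R - r%:R) / k%:R| <= C / k%:R ^+ 2)).
Proof.
split=> [k n G r k_gt0 _ <- | n r r_gt0 le_rn].
  exact: derangement_prop_ge.
case: r r_gt0 le_rn => // r _ le_rn.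
(* With [r.+1] orbits wanted, blocks below [r] get a colour each and all the others share colour
   [r]. *)
pose f (i : 'I_n) : 'I_r.+1 := inord (minn i r).
have orbE k : num_orbits (colour_group f k) = r.+1.
  rewrite num_orbits_colour_group -[RHS]card_ord -cardsT.
  congr #|pred_of_set _|.
  apply/setP => j; rewrite in_setT; apply/imsetP.
  exists (widen_ord le_rn j) => //.
  by rewrite /f /= (minn_idPl (leq_ord j)) inord_val.
exists (colour_group f); split=> [k _ // |].
(* The error constant [n ^ 2] works for every positive [k], so the threshold can be 0. *)
exists (n ^ 2)%:R, 0 => k k_gt0 _.
by have := derangement_prop_colour_le f k_gt0; rewrite orbE.
Qed.
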